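(* Let $\widehat\theta_T$ be an estimator of $\theta$ based on $X_{(T)}$ and let $S=S(T)$ satisfy $S(T)\le T$ for all $T$ and $S(T)\sim T$ as $T\to\infty$. Assume that for all $\theta\in\Theta$: 1. there is $m\in(2,\infty]$ such that $\sup_{T}\|\Delta r\|_{\mathrm L^m((\Delta f)\lambda)}<\infty$ and $\bar\beta(S,T)=o\big(T^{-m/(m-2)}\big)$ as $T\to\infty$ (exponent $-1$ if $m=\infty$); 2. $\lim_{T\to\infty}T\,\mathrm E_\theta\|\widehat\theta_T-\widehat\theta_S\|_{\mathbb R^d}^2=0$; 3. the limits $\lim_{T\to\infty}T\rho_T^S(\theta)$ and $\lim_{T\to\infty}T\rho_T(\theta)$ exist and are equal to a common matrix $R(\theta)\in\mathbb R^{k\times k}$. Assume moreover that there is a deterministic constant $C>0$ such that $$\|r(X_T,\theta^* )-r(X_T,\theta)\|_{\mathbb R^k}\le C\,\|\theta^*-\theta\|_{\mathbb R^d}\qquad\text{for all }\theta,\theta^*\in\Theta .$$ Then $\lim_{T\to\infty}TR_T(\theta)=\lim_{T\to\infty}T\rho_T(\theta)$ for all $\theta\in\Theta$.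
   Context: Setting. $(X_t,\ t\ge0)$ (time set $\mathbb N$ or $\mathbb R_+$) is a random process with values in a measurable space $(E,\mathcal B)$, with distribution $\mathrm P_\theta$, $\theta\in\Theta\subset\mathbb R^d$. $X_{(T)}=(X_t,\ 0\le t\le T)$. $(Y_t)$ is an $\mathbb R^k$-valued process, and $r(x,\theta)=\mathrm E_\theta(Y_T\mid X_T=x)\in\mathbb R^k$ is assumed not to depend on $T$, is measurable in $(x,\theta)$ and differentiable in $\theta$ on $\Theta$, with Jacobian $\mathrm J_\theta r(x,\theta)$. $\mu_\theta$ is the distribution of $X_T$ under $\mathrm P_\theta$, assumed not to depend on $T$; $r(\cdot,\theta)$ and $\mathrm J_\theta r(\cdot,\theta)$ are in $\mathrm L^2(\mu_\theta)$. Risks ($A^{\times2}=AA'$, $S=S(T)$; $\widehat\theta_S$ is the estimator based on $X_{(S)}$): $\rho_T(\theta)=\int_E\mathrm E_\theta(r(x,\widehat\theta_T)-r(x,\theta))^{\times2}d\mu_\theta(x)$, $R_T(\theta)=\mathrm E_\theta(r(X_T,\widehat\theta_T)-r(X_T,\theta))^{\times2}$, $\rho_T^S(\theta)=\int_E\mathrm E_\theta(r(x,\widehat\theta_S)-r(x,\theta))^{\times2}d\mu_\theta(x)$. Dependence. $\mathcal X_S$ is the space of paths of $X_{(S)}$ with the $\sigma$-field generated by the coordinate maps, and $\bar\theta_S:\mathcal X_S\to\Theta$ is the map with $\bar\theta_S(X_{(S)})=\widehat\theta_S$. Put $\Delta r(x,\xi)=r(x,\bar\theta_S(\xi))-r(x,\theta)$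 for $x\in E$, $\xi\in\mathcal X_S$. The law of $(X_T,X_{(S)})$ under $\mathrm P_\theta$ is assumed dominated by a $\sigma$-finite measure $\lambda$ on $E\times\mathcal X_S$, with joint density $f_{\theta,(X_T,X_{(S)})}$; $f_{\theta,X_T}$ and $f_{\theta,X_{(S)}}$ are the densities of $X_T$ and $X_{(S)}$, so that $f_{\theta,X_T}(x)f_{\theta,X_{(S)}}(\xi)$ is the $\lambda$-density of the product of the laws of $X_T$ and $X_{(S)}$. Put $\Delta f(x,\xi)=|f_{\theta,(X_T,X_{(S)})}(x,\xi)-f_{\theta,X_T}(x)f_{\theta,X_{(S)}}(\xi)|$ and $\bar\beta(S,T)=\int_{E\times\mathcal X_S}\Delta f\,d\lambda$. $\mathrm L^m((\Delta f)\lambda)$ is the $\mathrm L^m$ space of the measure with $\lambda$-density $\Delta f$. ($\Delta r,\Delta f$ depend on $T$ and $\theta$.) *)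

(* Defs.v *)
From HB Require Import structures.
From mathcomp Require Import all_boot all_order all_algebra.
From mathcomp Require Import all_classical all_reals all_analysis.
From mathcomp Require Import measurable_realfun.

Set Implicit Arguments.
Unset Strict Implicit.
Unset Printing Implicit Defensive.

Import Order.TTheory GRing.Theory Num.Theory.
Import numFieldNormedType.Exports.

Local Open Scope classical_set_scope.
Local Open Scope ring_scope.

(* Euclidean norm; the norm `|v| that the library puts on 'cV[R]_n is the
   maximum norm. *)
Definition enorm (R : realType) (n : nat) (v : 'cV[R]_n) : R :=
  Num.sqrt (\sum_(i < n) v i 0 ^+ 2).

Definition outer (R : realType) (k : nat) (v : 'cV[R]_k) : 'M[R]_k :=
  v *m v^T.

Notation borelV R n := (g_sigma_algebraType (@open 'cV[R]_n)).

(* Measurability of the restriction of f to D for the trace sigma-algebra on D.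
   For measurable D this is measurable_fun D f; when D is not measurable,
   measurable_fun D f holds vacuously. *)
Definition trace_measurable_fun d d' (T : measurableType d)
    (T' : measurableType d') (D : set T) (f : T -> T') : Prop :=
  forall B, measurable B ->
    exists2 A, measurable A & D `&` f @^-1` B = D `&` A.

(* N and R_+, both as subsets of R. *)
Definition is_time_set (R : realType) (time : set R) : Prop :=
  time = [set n%:R | n in [set: nat]] \/ time = [set t | 0 <= t].

(* T -> +oo with T restricted to the time set. *)
Definition time_oo (R : realType) (time : set R) : set_system R :=
  within time +oo.

#[global] Instance time_oo_filter (R : realType) (time : set R) : Filter (time_oo time).
Proof. exact: within_filter. Qed.

Canonical time_oo_filter_on (R : realType) (time : set R) : filter_on R :=
  FilterType (time_oo time) (time_oo_filter time).

Definition window (R : realType) (time : set R) (S : R) : Type :=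
  {t : R | time t /\ t <= S}.

(* A space of paths with time set I is given by its coordinate maps
   ev x t = x(t). It may be all of I -> E or a smaller set of trajectories. *)
Definition cylinders d (E : measurableType d) (I : Type) (paths : Type)
    (ev : paths -> I -> E) : set (set paths) :=
  \bigcup_(t in [set: I]) preimage_set_system [set: paths] (ev^~ t) measurable.

Notation pathType ev := (g_sigma_algebraType (cylinders ev)).

Definition is_density d (T : measurableType d) (R : realType)
    (nu : set T -> \bar R) (f : T -> R) (mu : set T -> \bar R) : Prop :=
  (forall z, 0 <= f z) /\
  forall A, measurable A -> mu A = (\int[nu]_(z in A) (f z)%:E)%E.

Definition Delta_r (R : realType) (d k : nat) (E Xi : Type)
    (r : E -> 'cV[R]_d -> 'cV[R]_k) (theta : 'cV[R]_d) (thbar : Xi -> 'cV[R]_d)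
    (z : E * Xi) : 'cV[R]_k :=
  r z.1 (thbar z.2) - r z.1 theta.

Section delta_f.
Context d1 d2 (E : measurableType d1) (Xi : measurableType d2) (R : realType).
Variables (lambda : {measure set (E * Xi) -> \bar R})
  (f : {mfun (E * Xi)%type >-> R}) (fX : {mfun E >-> R})
  (fXi : {mfun Xi >-> R}).

Definition Delta_f (z : E * Xi) : R := `| f z - fX z.1 * fXi z.2 |.

Lemma Delta_f_ge0 z : 0 <= Delta_f z.
Proof. exact: normr_ge0. Qed.

Lemma measurable_Delta_f : measurable_fun [set: E * Xi] Delta_f.
Proof.
apply: measurableT_comp => //; apply: measurable_funB => //=.
by apply: measurable_funM; apply: measurableT_comp.
Qed.

Definition beta_bar : R := \int[lambda]_z Delta_f z.

Definition Delta_f_measure (A : set (E * Xi)) : \bar R :=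
  (\int[lambda]_(z in A) (Delta_f z)%:E)%E.

Let Delta_f_measure0 : Delta_f_measure set0 = 0%E.
Proof. exact: integral_set0. Qed.

Let Delta_f_measure_ge0 A : (0 <= Delta_f_measure A)%E.
Proof. by apply: integral_ge0 => z _; rewrite lee_fin Delta_f_ge0. Qed.

Let Delta_f_measure_sigma_additive : semi_sigma_additive Delta_f_measure.
Proof.
move=> F mF tF mUF; rewrite /Delta_f_measure ge0_integral_bigcup//=.
- apply: is_cvg_ereal_nneg_natsum_cond => n _ _.
  by apply: integral_ge0 => z _; rewrite lee_fin Delta_f_ge0.
- by apply/measurable_EFinP; exact: measurable_funTS measurable_Delta_f.
- by move=> z _; rewrite lee_fin Delta_f_ge0.
Qed.

HB.instance Definition _ := isMeasure.Build _ _ _ Delta_f_measure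
  Delta_f_measure0 Delta_f_measure_ge0 Delta_f_measure_sigma_additive.

End delta_f.

(* m / (m - 2), equal to 1 for m = +oo. *)
Definition mixing_exponent (R : realType) (m : \bar R) : R :=
  if m is r%:E%E then r / (r - 2) else 1.

(* g is a version of x |-> E(Y | X = x), where mu is the law of X. *)
Definition is_regression d1 d2 (Omega : measurableType d1)
    (E : measurableType d2) (R : realType) (k : nat) (P : probability Omega R)
    (X : Omega -> E) (Y : Omega -> 'cV[R]_k) (mu : probability E R)
    (g : E -> 'cV[R]_k) : Prop :=
  forall i, P.-integrable [set: Omega] (fun w => (Y w i 0)%:E) /\
    forall B, measurable B ->
      (\int[P]_(w in X @^-1` B) (Y w i 0)%:E =
       \int[mu]_(x in B) (g x i 0)%:E)%E.

Section risks.
Context d1 d2 (Omega : measurableType d1) (E : measurableType d2)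
  (R : realType) (d k : nat).
Variables (P : probability Omega R) (r : E -> 'cV[R]_d -> 'cV[R]_k)
  (theta : 'cV[R]_d) (est : Omega -> 'cV[R]_d).

(* The entries are integrals in \bar R, so that an infinite risk is not
   silently replaced by a finite default value. *)
Definition indep_risk (mu : probability E R) : 'M[\bar R]_k :=
  \matrix_(i, j) (\int[mu]_x
    'E_P[fun w => outer (r x (est w) - r x theta) i j])%E.

Definition pred_risk (X : Omega -> E) : 'M[\bar R]_k :=
  \matrix_(i, j)
    ('E_P[fun w => outer (r (X w) (est w) - r (X w) theta) i j])%E.

End risks.

(* T * A T --> L entrywise, with a finite limit L. *)
Definition scaled_cvg (R : realType) (k : nat) (time : set R)
    (A : R -> 'M[\bar R]_k) (L : 'M[R]_k) : Prop :=
  forall i j,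
    (T%:E * A T i j)%E @[T --> time_oo time] --> (L i j)%:E.

(* Main.v *)
(* Let a and b be the prediction errors r(X_T, est) - r(X_T, theta) for est based
   on X_(T) and on X_(S).  The product moments of b and the entries of rho_T^S
   are the integrals of the same functions Delta_r_i Delta_r_j against the joint
   density and against the product density, so they differ by at most
   int |Delta_r|^2 Delta_f, which Hoelder's inequality with exponents m/2 and
   m/(m-2) bounds by ||Delta_r||_m^2 beta^((m-2)/m) = o(1/T).  By the Lipschitz
   assumption |a - b| <= C |est_T - est_S|, and by AM-GM with a small weight eta
   the product moments of a and b differ by at most
   eta E|b|^2 + (1/eta + 1) C^2 E|est_T - est_S|^2 = eta O(1/T) + o(1/T). *)
Require Import Defs.
From HB Require Import structures.
From mathcomp Require Import all_boot all_order all_algebra.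
From mathcomp Require Import all_classical all_reals all_analysis.
From mathcomp Require Import measurable_realfun ess_sup_inf ring lra.

Set Implicit Arguments.
Unset Strict Implicit.
Unset Printing Implicit Defensive.

Import Order.TTheory GRing.Theory Num.Theory.
Import numFieldNormedType.Exports.

Local Open Scope classical_set_scope.
Local Open Scope ring_scope.

(** * Integration against a density, and stability of integrals under perturbation *)

Section integration.
Context d (T : measurableType d) (R : realType).

Import HBNNSimple.

(** By [is_density] the identity holds for indicators; linearity extends it to simple functions and
    monotone convergence to nonnegative [g]. *)
Lemma ge0_integral_density (mu nu : {measure set T -> \bar R}) (f g : T -> R) :
    measurable_fun setT f -> is_density nu f mu ->
    measurable_fun setT g -> (forall x, 0 <= g x) ->
  (\int[mu]_x (g x)%:E = \int[nu]_x (g x * f x)%:E)%E.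
Proof.
move=> mf [f0 muf] mg g0.
have mEg : measurable_fun setT (EFin \o g) by exact/measurable_EFinP.
pose g_ := nnsfun_approx measurableT mEg.
have cvg_g x : EFin (g_ n x) @[n --> \oo] --> (g x)%:E.
  by apply: (cvg_nnsfun_approx measurableT mEg) => // y _; rewrite lee_fin.
have mgf n : measurable_fun setT (fun x => (g_ n x * f x)%:E).
  by apply/measurable_EFinP; exact: measurable_funM.
(* Monotone convergence is applied to both sides, which reduces the claim to each simple function
   [g_ n]; on the right, [f >= 0] keeps the products nondecreasing in [n]. *)
transitivity (limn (fun n => \int[mu]_x (g_ n x)%:E)%E).
  rewrite -monotone_convergence//.
  - by apply: eq_integral => x _; exact/esym/cvg_lim.
  - by move=> n; exact/measurable_EFinP/measurable_funP.
  - by move=> n x _; rewrite lee_fin.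
  - by move=> x _ m n mn; rewrite lee_fin; exact/lefP/nd_nnsfun_approx.
rewrite [X in limn X](_ : _ = (fun n => \int[nu]_x (g_ n x * f x)%:E)%E).
  rewrite -monotone_convergence//.
  - apply: eq_integral => x _; apply/cvg_lim => //.
    under eq_fun do rewrite EFinM.
    by rewrite EFinM; apply: cvgeZr => //; exact: cvg_g.
  - by move=> n x _; rewrite lee_fin mulr_ge0.
  - move=> x _ m n mn; rewrite lee_fin ler_wpM2r//.
    exact/lefP/nd_nnsfun_approx.
apply/funext => n.
transitivity (\sum_(k \in range (g_ n))
    \int[nu]_x (k * \1_(g_ n @^-1` [set k]) x * f x)%:E)%E.
  under eq_integral do rewrite fimfunE -fsumEFin//.
  rewrite ge0_integral_fsum//; last 2 first.
  - by move=> y; exact/measurable_EFinP/measurable_funM.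
  - by move=> y x _; rewrite nnfun_muleindic_ge0.
  apply: eq_fsbigr => k _; rewrite integralZl_indic_nnsfun// integral_indic//=.
  rewrite setIT muf// integral_mkcond.
  (* For [k < 0] the level set is empty, since [g_ n] is nonnegative, and both sides vanish. *)
  have [k0|k0] := leP 0 k.
    rewrite -ge0_integralZl//=.
    - apply: eq_integral => x _; rewrite patchE indicE.
      by case: ifP => _; rewrite ?mulr1 ?mulr0 ?mul0r ?mule0// EFinM.
    - by apply: (measurable_restrictT _ _).1 => //;
        apply: measurable_funTS; exact/measurable_EFinP.
    - by move=> x _; rewrite patchE; case: ifP => //; rewrite lee_fin.
  rewrite preimage_nnfun0//= [in RHS]integral0_eq//.
    by rewrite integral0_eq ?mule0// => x _; rewrite patchE in_set0.
  by move=> x _; rewrite indicE in_set0 mulr0 mul0r.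
rewrite -ge0_integral_fsum//.
- apply: eq_integral => x _; rewrite fsumEFin//; congr EFin.
  by rewrite [in RHS]fimfunE mulrC mulr_fsumr; apply: eq_fsbigr => k _; rewrite mulrC.
- move=> k; apply/measurable_EFinP; apply: measurable_funM => //.
  exact: measurable_funM.
- by move=> k x _; rewrite EFinM mule_ge0// ?nnfun_muleindic_ge0// lee_fin.
Qed.

(** Multiplication by [f >= 0] commutes with positive and negative parts, so the nonnegative case
    applies to each part and no integrability of [g] enters. *)
Lemma integral_density (mu nu : {measure set T -> \bar R}) (f g : T -> R) :
    measurable_fun setT f -> is_density nu f mu -> measurable_fun setT g ->
  (\int[mu]_x (g x)%:E = \int[nu]_x (g x * f x)%:E)%E.
Proof.
move=> mf muf mg; have f0 := muf.1.
rewrite integralE [RHS]integralE; congr (_ - _)%E.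
- rewrite (_ : (fun x => (g x)%:E)^\+%E = EFin \o g^\+); last first.
    by apply/funext => x /=; rewrite funeposE /funrpos -EFin_max.
  rewrite (ge0_integral_density mf muf)//; last exact: measurable_funrpos.
  apply: eq_integral => x _; rewrite funeposE /funrpos -EFin_max.
  by rewrite maxr_pMl// mul0r.
- rewrite (_ : (fun x => (g x)%:E)^\-%E = EFin \o g^\-); last first.
    by apply/funext => x /=; rewrite funenegE /funrneg -EFinN -EFin_max.
  rewrite (ge0_integral_density mf muf)//; last exact: measurable_funrneg.
  apply: eq_integral => x _; rewrite funenegE /funrneg -EFinN -EFin_max.
  by rewrite maxr_pMl// mul0r mulNr.
Qed.

(* Unlike [integral_pushforward], this needs no integrability: both sides are
   the same difference of integrals of nonnegative functions. *)
Lemma integral_pushforwardT d' (T' : measurableType d')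
    (mu : {measure set T -> \bar R}) (phi : T -> T') (g : T' -> \bar R) :
    measurable_fun setT phi -> measurable_fun setT g ->
  (\int[pushforward mu phi]_y g y = \int[mu]_x g (phi x))%E.
Proof.
move=> mphi mg; rewrite [LHS]integralE// [RHS]integralE.
rewrite (ge0_integral_pushforward mphi)//; last exact: measurable_funepos.
rewrite (ge0_integral_pushforward mphi)//; last exact: measurable_funeneg.
by rewrite preimage_setT -funepos_comp -funeneg_comp.
Qed.

(** Integrability of [u2] is a conclusion: [u2] is [u1] plus a difference dominated by [w]. The
    lemma serves twice, under [lambda] to exchange densities and under [P] to exchange
    estimators. *)
Lemma integral_perturbation (mu : {measure set T -> \bar R}) (u1 u2 w : T -> R)
    (B : R) :
    measurable_fun setT u2 -> measurable_fun setT w ->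
    mu.-integrable setT (EFin \o u1) ->
    {ae mu, forall x, `|u2 x - u1 x| <= w x} ->
    (\int[mu]_x `|w x|%:E <= B%:E)%E ->
  mu.-integrable setT (EFin \o u2) /\
  (`|\int[mu]_x (u2 x)%:E - \int[mu]_x (u1 x)%:E| <= B%:E)%E.
Proof.
move=> mu2 mw iu1 u12 wB.
have mu1 : measurable_fun setT u1 by exact/measurable_EFinP/(measurable_int _ iu1).
have mu12 : measurable_fun setT (u2 \- u1)%R by exact: measurable_funB.
have u12B : (\int[mu]_x `|(u2 \- u1) x|%:E <= B%:E)%E.
  apply: le_trans wB; apply: ae_ge0_le_integral => //=.
  - by apply/measurable_EFinP; exact: measurableT_comp.
  - by apply/measurable_EFinP; exact: measurableT_comp.
  - by apply: filterS u12 => x xw _; rewrite lee_fin (le_trans xw)// ler_norm.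
have iu12 : mu.-integrable setT (EFin \o (u2 \- u1)%R).
  apply/integrableP; split; first exact/measurable_EFinP.
  by apply: le_lt_trans u12B _; rewrite ltry.
have iu2 : mu.-integrable setT (EFin \o u2).
  rewrite (_ : EFin \o u2 = (EFin \o u1) \+ (EFin \o (u2 \- u1)%R))%E.
    exact: integrableD.
  by apply/funext => x /=; rewrite -EFinD subrKC.
split=> //; rewrite -integralB_EFin//.
apply: le_trans u12B.
by apply: (le_abse_integral mu measurableT); exact/measurable_EFinP.
Qed.

End integration.

(** * Measurability of the regression function along random arguments *)

Section measurability.
Context (R : realType).

Lemma measurable_coord n (i : 'I_n) :
  @measurable_fun _ _ (borelV R n) R setT (fun v : 'cV[R]_n => v i 0).
Proof.
apply: (measurability (@RGenOInfty.G R)); first exact: RGenOInfty.measurableE.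
move=> _ [_ [x ->] <-]; rewrite setTI; apply: sub_sigma_algebra.
by apply: open_comp; [move=> v _; exact: coord_continuous|exact: interval_open].
Qed.

(** Since [phi] stays in [D], the preimage under [phi] of a trace [D] with [A] is the preimage of
    [A] itself, which is measurable whether or not [D] is. *)
Lemma trace_measurable_fun_comp d1 d2 d3 (T1 : measurableType d1)
    (T2 : measurableType d2) (T3 : measurableType d3) (D : set T2)
    (g : T2 -> T3) (phi : T1 -> T2) :
    trace_measurable_fun D g -> measurable_fun setT phi ->
    (forall x, D (phi x)) ->
  measurable_fun setT (g \o phi).
Proof.
move=> mg mphi Dphi _ B /mg[A mA DgA]; rewrite setTI.
rewrite (_ : _ @^-1` B = setT `&` phi @^-1` A); first exact: mphi.
apply/seteqP; split => x /= Bx.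
  by have [] : (D `&` A) (phi x) by rewrite -DgA; split; [exact: Dphi|].
by have [] : (D `&` g @^-1` B) (phi x) by rewrite DgA; split; [exact: Dphi|case: Bx].
Qed.

Lemma measurable_regression d1 d2 (T : measurableType d1)
    (E : measurableType d2) n k (Theta : set 'cV[R]_n)
    (r : E -> 'cV[R]_n -> 'cV[R]_k) (x : T -> E) (t : T -> borelV R n) i :
    @trace_measurable_fun _ _ (E * borelV R n)%type (borelV R k)
      ([set: E] `*` Theta) (fun z => r z.1 z.2) ->
    measurable_fun setT x -> measurable_fun setT t ->
    (forall w, Theta (t w)) ->
  measurable_fun setT (fun w => r (x w) (t w) i 0).
Proof.
move=> mr mx mt Thetat; apply: (measurableT_comp (measurable_coord i)).
apply: (trace_measurable_fun_comp (phi := fun w => (x w, t w)) mr).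
  exact/measurable_fun_pair.
by move=> w; split => //; exact: Thetat.
Qed.

Lemma measurable_enorm d (T : measurableType d) n (v : T -> 'cV[R]_n) :
  (forall i, measurable_fun setT (fun x => v x i 0)) ->
  measurable_fun setT (fun x => enorm (v x)).
Proof.
move=> mv; rewrite /enorm.
apply: (measurableT_comp (f := @Num.sqrt R)).
  by apply: continuous_measurable_fun; exact: sqrt_continuous.
by apply: measurable_sum => i; exact: measurable_funX.
Qed.

End measurability.

(** * Second moments on a finite measure space *)

Section moments.
Context d (T : measurableType d) (R : realType) (mu : {measure set T -> \bar R}).

(** For finite [m] this is Hoelder's inequality for [h ^+ 2] and the constant 1, with exponents
    [m / 2] and [m / (m - 2)]; the second is [mixing_exponent m], whence the power of the total mass
    [b]. For [m = +oo] it integrates the essential bound [h <= K]. *)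
Lemma integral_sqr_le_Lnorm (m : \bar R) (h : T -> R) (K b : R) :
    (2%:E < m)%E -> measurable_fun setT h -> (forall x, 0 <= h x) ->
    (Lnorm mu m (EFin \o h) <= K%:E)%E -> mu setT = b%:E ->
  (\int[mu]_x (h x ^+ 2)%:E <= (K ^+ 2 * b `^ (mixing_exponent m)^-1)%:E)%E.
Proof.
move=> m2 mh h0 hK mub.
have mh2 : measurable_fun setT (fun x => h x ^+ 2) by exact: measurable_funX.
have K0 : 0 <= K by rewrite -lee_fin (le_trans (Lnorm_ge0 mu m (EFin \o h))).
have b0 : 0 <= b by rewrite -lee_fin -mub.
move: m m2 hK => [r| |] //= => [|_].
  rewrite lte_fin => r2 hK.
  have r0 : 0 < r by apply: lt_trans r2.
  have rn0 : r != 0 by rewrite gt_eqF.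
  have r20 : 0 < r - 2 by rewrite subr_gt0.
  have p0 : 0 < r / 2 by rewrite divr_gt0.
  have q0 : 0 < r / (r - 2) by rewrite divr_gt0.
  have pq : (r / 2)^-1 + (r / (r - 2))^-1 = 1.
    by rewrite !invf_div -mulrDl subrKC divff.
  have := hoelder mu mh2 (measurable_cst (1 : R)) p0 q0 pq.
  rewrite Lnorm1 Lnorm_cst1 mub.
  under eq_integral do rewrite /= mulr1 ger0_norm ?sqr_ge0//.
  move=> /le_trans; apply.
  (* The norm of exponent [r / 2] of [h ^+ 2] is the square of the norm of exponent [r] of [h]. *)
  have -> : ('N[mu]_(r / 2)%:E[EFin \o (fun x => (h x ^+ 2)%R)] =
      'N[mu]_r%:E[EFin \o h] `^ 2)%E.
    rewrite unlock -poweRrM invf_div [2 / r]mulrC; congr (_ `^ _)%E.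
    apply: eq_integral => x _ /=; congr EFin.
    rewrite !ger0_norm ?sqr_ge0// -powR_mulrn// -powRrM.
    by congr (_ `^ _); field.
  rewrite EFinM poweR_EFin; apply: lee_wpmul2r; first by rewrite lee_fin powR_ge0.
  rewrite -powR_mulrn// -poweR_EFin; apply: gt0_ler_poweR => //.
  - by rewrite in_itv/= Lnorm_ge0 leey.
  - by rewrite in_itv/= lee_fin K0 leey.
rewrite invr1 powRr1// => hK.
(* The norm of exponent [+oo] is the essential supremum only if [mu] has positive mass. Otherwise it
   is 0 by convention, and the bound holds almost everywhere because the whole space is
   negligible. *)
have hK' : \forall x \ae mu, ((h x)%:E <= K%:E)%E.
  move: hK; rewrite unlock; case: ifPn => [_ /ess_supP|].
    by apply: filterS => x /=; rewrite ger0_norm.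
  rewrite -leNgt measure_le0 => /eqP mu0 _.
  by exists setT; split.
rewrite EFinM -mub -integral_cst//.
apply: ae_ge0_le_integral => //.
- by move=> x _; rewrite lee_fin sqr_ge0.
- exact/measurable_EFinP.
- by move=> x _; rewrite lee_fin sqr_ge0.
- by apply: filterS hK' => x; rewrite !lee_fin => hx _; rewrite lerXn2r ?nnegrE.
Qed.

End moments.

Section euclidean_norm.
Context (R : realType) (n : nat).
Implicit Type v : 'cV[R]_n.

Lemma enorm_ge0 v : 0 <= enorm v. Proof. exact: sqrtr_ge0. Qed.

Lemma coord_le_enorm v i : `|v i 0| <= enorm v.
Proof.
rewrite -sqrtr_sqr ler_wsqrtr// (bigD1 i)//= lerDl.
by apply: sumr_ge0 => j _; exact: sqr_ge0.
Qed.

Lemma coordM_le_enorm v i j : `|v i 0 * v j 0| <= enorm v ^+ 2.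
Proof. by rewrite normrM expr2 ler_pM// coord_le_enorm. Qed.

Lemma outerE v i j : outer v i j = v i 0 * v j 0.
Proof. by rewrite /outer mxE big_ord1 mxE. Qed.

End euclidean_norm.

(** * Joint law against product law of the predictor and the observed path *)

Section risk_comparison.
Context d1 d2 d3 (Omega : measurableType d1) (E : measurableType d2)
  (Xi : measurableType d3) (R : realType) (d k : nat).
Variables (P : probability Omega R) (mu : probability E R)
  (X : {mfun Omega >-> E}) (tr : {mfun Omega >-> Xi})
  (r : E -> 'cV[R]_d -> 'cV[R]_k) (theta : 'cV[R]_d) (th : Xi -> 'cV[R]_d).
Variables (lambda : {measure set (E * Xi) -> \bar R})
  (f : {mfun (E * Xi)%type >-> R}) (fX : {mfun E >-> R}) (fXi : {mfun Xi >-> R}).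
Hypothesis lawX : forall A, measurable A -> distribution P X A = mu A.
Hypothesis f_density :
  is_density lambda f (pushforward P (fun w => (X w, tr w))).
Hypothesis fXfXi_density : is_density lambda (fun z => fX z.1 * fXi z.2)
  (distribution P X \x distribution P tr)%E.
Hypothesis mDr : forall i, measurable_fun setT (fun z => Delta_r r theta th z i 0).

Let Dr := Delta_r r theta th.
Let g i j z := Dr z i 0 * Dr z j 0.
Let fp z := fX z.1 * fXi z.2.
Let rho := indep_risk P r theta (fun w => th (tr w)) mu.

Let mg i j : measurable_fun setT (g i j).
Proof. exact: measurable_funM. Qed.

Let g_ge0 i z : 0 <= g i i z.
Proof. by rewrite /g -expr2 sqr_ge0. Qed.

Let mfp : measurable_fun setT fp.
Proof. by apply: measurable_funM; apply: measurableT_comp. Qed.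

Let mXtr : measurable_fun setT (fun w => (X w, tr w)).
Proof. exact/measurable_fun_pair. Qed.

Let indep_riskE i j : rho i j =
  (\int[distribution P X]_x \int[distribution P tr]_xi (g i j (x, xi))%:E)%E.
Proof.
rewrite mxE; under [LHS]eq_integral do rewrite unlock.
rewrite -(@eq_measure_integral _ _ _ _ _ (distribution P X)); last first.
  by move=> A mA _; exact: lawX.
apply: eq_integral => x _; rewrite integral_pushforwardT//.
  by apply: eq_integral => w _; rewrite outerE.
apply/measurable_EFinP; exact: measurableT_comp.
Qed.

(** On the diagonal the integrand is a square, so Tonelli applies before any finiteness is known; a
    finite diagonal risk thereby yields integrability. *)
Let indep_risk_diag i : rho i i = (\int[lambda]_z (g i i z * fp z)%:E)%E.
Proof.
rewrite -(integral_density mfp fXfXi_density)// fubini_tonelli1//.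
- exact/measurable_EFinP.
- by move=> z; rewrite lee_fin.
Qed.

Let g_le i j z : `|g i j z| <= g i i z + g j j z.
Proof.
rewrite ler_norml /g; apply/andP; split; nra.
Qed.

(** The bound [g_le] dominates an off-diagonal product by the two diagonal ones, so finite diagonal
    risks control every entry. *)
Let integrable_gfp i j : (forall i, rho i i < +oo)%E ->
  lambda.-integrable setT (fun z => (g i j z * fp z)%:E).
Proof.
move=> rhoy.
have intd l : lambda.-integrable setT (fun z => (g l l z * fp z)%:E).
  apply/integrableP; split; first exact/measurable_EFinP/measurable_funM.
  under eq_integral => z _.
    rewrite gee0_abs; last by rewrite lee_fin mulr_ge0// fXfXi_density.1.
    over.
  by rewrite -indep_risk_diag.
apply: le_integrable (integrableD measurableT (intd i) (intd j)) => //.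
  exact/measurable_EFinP/measurable_funM.
move=> z _ /=; rewrite lee_fin -mulrDl normrM [leRHS]normrM ler_wpM2r//.
by rewrite (le_trans (g_le i j z))// ler_norm.
Qed.

(** Off the diagonal the sign of [g i j] varies and Fubini requires integrability under the product
    law; it is carried over from [integrable_gfp] through the density [fp]. *)
Let indep_risk_density i j : (forall i, rho i i < +oo)%E ->
  rho i j = (\int[lambda]_z (g i j z * fp z)%:E)%E.
Proof.
move=> rhoy; rewrite -(integral_density mfp fXfXi_density)// indep_riskE.
apply: integral12_prod_meas1.
apply/integrableP; split; first exact/measurable_EFinP.
rewrite [ltLHS](integral_density mfp fXfXi_density (g := fun z => `|g i j z|)).
  have /integrableP[_] := integrable_gfp i j rhoy.
  apply: le_lt_trans; apply: ge0_le_integral => //.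
  - by move=> z _; rewrite lee_fin mulr_ge0// fXfXi_density.1.
  - by apply/measurable_EFinP; apply: measurable_funM => //; exact: measurableT_comp.
  - by apply: measurableT_comp => //; exact/measurable_EFinP/measurable_funM.
  - by move=> z _; rewrite lee_fin [leRHS]normrM ler_wpM2l// ler_norm.
exact: measurableT_comp.
Qed.

(* The two moments are the integrals of the same function against the two
   lambda-densities whose absolute difference is Delta_f. *)
Lemma mixing_risk_comparison (B : R) i j : (forall i, rho i i < +oo)%E ->
    (\int[lambda]_z (enorm (Dr z) ^+ 2 * Delta_f f fX fXi z)%:E <= B%:E)%E ->
  [/\ rho i j \is a fin_num,
      P.-integrable setT (fun w => (g i j (X w, tr w))%:E) &
      (`|\int[P]_w (g i j (X w, tr w))%:E - rho i j| <= B%:E)%E].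
Proof.
move=> rhoy hB; have intg := integrable_gfp i j rhoy.
have mDf := measurable_Delta_f f fX fXi.
have menDr : measurable_fun setT (fun z => enorm (Dr z) ^+ 2).
  by apply: measurable_funX; exact: measurable_enorm.
(* The reference function is the one with the product density, where finiteness is known;
   integrability with the joint density results from the bound [B]. *)
have [] := @integral_perturbation _ _ _ lambda (fun z => g i j z * fp z)
    (fun z => g i j z * f z) (fun z => enorm (Dr z) ^+ 2 * Delta_f f fX fXi z)
    B _ _ intg.
- exact: measurable_funM.
- exact: measurable_funM.
- apply: nearW => z /=; rewrite -mulrBr normrM ler_wpM2r//.
  exact: coordM_le_enorm.
- rewrite (le_trans _ hB)//; under eq_integral => z _.
    rewrite ger0_norm; last by rewrite mulr_ge0 ?Delta_f_ge0// sqr_ge0.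
    over.
  by [].
move=> intgf; rewrite -indep_risk_density// => gB.
have Pg : (\int[P]_w (g i j (X w, tr w))%:E = \int[lambda]_z (g i j z * f z)%:E)%E.
  rewrite -(integral_pushforwardT P mXtr (g := fun z => (g i j z)%:E)).
    by rewrite (integral_density (measurable_funP f) f_density).
  exact/measurable_EFinP.
split; last by rewrite Pg.
- by rewrite indep_risk_density// integrable_fin_num.
(* Under [P] the absolute moment is the [lambda]-integral of [|g i j| * f], which equals
   [|g i j * f|] because [f >= 0]. *)
- apply/integrableP; split.
    by apply/measurable_EFinP; exact: measurableT_comp.
  have /integrableP[_] := intgf.
  have := integral_pushforwardT P mXtr (g := fun z => `|(g i j z)%:E|%E).
  move=> <-; last by apply: measurableT_comp => //; exact/measurable_EFinP.
  rewrite (integral_density (measurable_funP f) f_density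
    (g := fun z => `|g i j z|))//; last exact: measurableT_comp.
  congr (_ < _)%E; apply: eq_integral => z _ /=.
  by rewrite normrM [`|f z|]ger0_norm// f_density.1.
Qed.

End risk_comparison.

(** * Exchange of the two estimators in the prediction error *)

(** In the expansion around [x * y], the two linear terms are split by AM-GM with weight [eta] and
    together give [eta^-1 * e ^+ 2]; the quadratic term accounts for the [+ 1]. *)
Lemma prod_perturbation (R : realFieldType) (x y x' y' e eta : R) :
    0 < eta -> `|x' - x| <= e -> `|y' - y| <= e ->
  `|x' * y' - x * y| <=
    eta / 2 * (x ^+ 2 + y ^+ 2) + (eta^-1 + 1) * e ^+ 2.
Proof.
move=> eta0 xe ye; have e0 : 0 <= e := le_trans (normr_ge0 _) xe.
have -> : x' * y' - x * y =
    x * (y' - y) + y * (x' - x) + (x' - x) * (y' - y) by ring.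
(* AM-GM: [|u| e <= eta u^2 / 2 + e^2 / (2 eta)] *)
have amgm u v : `|v| <= e -> `|u * v| <= eta / 2 * u ^+ 2 + eta^-1 / 2 * e ^+ 2.
  move=> ve; rewrite normrM (le_trans (ler_wpM2l (normr_ge0 u) ve))//.
  rewrite -subr_ge0 -[u ^+ 2]real_normK ?num_real//.
  suff -> : eta / 2 * `|u| ^+ 2 + eta^-1 / 2 * e ^+ 2 - `|u| * e =
      eta / 2 * (`|u| - eta^-1 * e) ^+ 2.
    by rewrite mulr_ge0 ?sqr_ge0// divr_ge0// ltW.
  by field; rewrite gt_eqF.
have h3 : `|(x' - x) * (y' - y)| <= e ^+ 2 by rewrite normrM expr2 ler_pM.
apply: (le_trans (ler_normD _ _)); apply: (le_trans (lerD (ler_normD _ _) h3)).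
apply: (le_trans (lerD (lerD (amgm _ _ ye) (amgm _ _ xe)) (lexx _))).
by rewrite le_eqVlt; apply/orP; left; apply/eqP; field; rewrite gt_eqF.
Qed.

(** The bound of [prod_perturbation] with [e = C * del] is integrated; each of the two diagonal
    moments of [b] contributes [eta / 2 * q]. *)
Lemma second_moment_perturbation d (T : measurableType d) (R : realType)
    (P : {measure set T -> \bar R}) (k : nat) (a b : T -> 'cV[R]_k)
    (del : T -> R) (C eta q D : R) i j :
    (forall i, measurable_fun setT (fun w => a w i 0)) ->
    (forall i, measurable_fun setT (fun w => b w i 0)) ->
    measurable_fun setT del ->
    (forall i j, P.-integrable setT (fun w => (b w i 0 * b w j 0)%:E)) ->
    (forall i, (\int[P]_w (b w i 0 * b w i 0)%:E <= q%:E)%E) ->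
    {ae P, forall w, enorm (a w - b w) <= C * del w} ->
    (\int[P]_w (del w ^+ 2)%:E <= D%:E)%E ->
    0 < eta ->
  P.-integrable setT (fun w => (a w i 0 * a w j 0)%:E) /\
  (`|\int[P]_w (a w i 0 * a w j 0)%:E - \int[P]_w (b w i 0 * b w j 0)%:E| <=
    (eta * q + (eta^-1 + 1) * C ^+ 2 * D)%:E)%E.
Proof.
move=> ma mb mdel ib bq ab delD eta0.
have idel : P.-integrable setT (fun w => (del w ^+ 2)%:E).
  apply/integrableP; split; first exact/measurable_EFinP/measurable_funX.
  under eq_integral do rewrite gee0_abs ?lee_fin ?sqr_ge0//.
  by rewrite (le_lt_trans delD)// ltry.
pose w x := eta / 2 * (b x i 0 ^+ 2 + b x j 0 ^+ 2) +
  (eta^-1 + 1) * (C * del x) ^+ 2.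
have w0 x : 0 <= w x.
  by rewrite addr_ge0// mulr_ge0 ?addr_ge0 ?sqr_ge0// ?divr_ge0 ?invr_ge0// ltW.
have mw : measurable_fun setT w.
  apply: measurable_funD; apply: measurable_funM => //.
    by apply: measurable_funD; exact: measurable_funX.
  by apply: measurable_funX; exact: measurable_funM.
apply: (@integral_perturbation _ _ _ P _ _ w _ _ mw (ib i j)).
- exact: measurable_funM.
- apply: filterS ab => x abx; apply: prod_perturbation => //.
    by apply: le_trans abx; rewrite (le_trans _ (coord_le_enorm _ i))// !mxE.
  by apply: le_trans abx; rewrite (le_trans _ (coord_le_enorm _ j))// !mxE.
under eq_integral do rewrite ger0_norm//.
have -> : (fun x => (w x)%:E) = (fun x =>
    ((eta / 2)%:E * (b x i 0 * b x i 0)%:E +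
     (eta / 2)%:E * (b x j 0 * b x j 0)%:E) +
    ((eta^-1 + 1) * C ^+ 2)%:E * (del x ^+ 2)%:E)%E.
  by apply/funext => x; rewrite -!EFinM -!EFinD /w; congr EFin; ring.
have ibZ l : P.-integrable setT (fun x => (eta / 2)%:E * (b x l 0 * b x l 0)%:E)%E.
  exact: integrableZl.
rewrite integralD//; last 2 first.
- exact: integrableD.
- exact: integrableZl.
rewrite integralD// !integralZl//.
have -> : eta * q + (eta^-1 + 1) * C ^+ 2 * D =
    eta / 2 * q + eta / 2 * q + (eta^-1 + 1) * C ^+ 2 * D.
  by field; rewrite gt_eqF.
have eta20 : (0 <= (eta / 2)%:E)%E by rewrite lee_fin divr_ge0// ltW.
rewrite !EFinD.
have step l : ((eta / 2)%:E * \int[P]_x (b x l 0 * b x l 0)%:E <= (eta / 2 * q)%:E)%E.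
  by rewrite [leRHS]EFinM lee_wpmul2l.
rewrite leeD//; first by apply: leeD; exact: step.
by rewrite [leRHS]EFinM lee_wpmul2l// lee_fin mulr_ge0 ?sqr_ge0// addr_ge0// invr_ge0 ltW.
Qed.

(** Triangle inequality through the product moment of the error [b] of the estimator based on the
    shorter path: [B] is the cost of replacing the product law by the joint law, the remaining terms
    that of exchanging the estimators. *)
Lemma pred_risk_comparison d1 d2 d3 (Omega : measurableType d1)
    (E : measurableType d2) (Xi : measurableType d3) (R : realType) (d k : nat)
    (P : probability Omega R) (mu : probability E R)
    (X : {mfun Omega >-> E}) (tr : {mfun Omega >-> Xi})
    (r : E -> 'cV[R]_d -> 'cV[R]_k) (theta : 'cV[R]_d) (th : Xi -> 'cV[R]_d)
    (est : Omega -> 'cV[R]_d) (lambda : {measure set (E * Xi) -> \bar R})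
    (f : {mfun (E * Xi)%type >-> R}) (fX : {mfun E >-> R})
    (fXi : {mfun Xi >-> R}) (B q D C eta : R) i j :
    (forall A, measurable A -> distribution P X A = mu A) ->
    is_density lambda f (pushforward P (fun w => (X w, tr w))) ->
    is_density lambda (fun z => fX z.1 * fXi z.2)
      (distribution P X \x distribution P tr)%E ->
    (forall i, measurable_fun setT (fun z => Delta_r r theta th z i 0)) ->
    (forall i, measurable_fun setT
      (fun w => (r (X w) (est w) - r (X w) theta) i 0)) ->
    measurable_fun setT (fun w => enorm (est w - th (tr w))) ->
    (forall i, indep_risk P r theta (th \o tr) mu i i <= q%:E)%E ->
    (\int[lambda]_z (enorm (Delta_r r theta th z) ^+ 2 * Delta_f f fX fXi z)%:E
      <= B%:E)%E ->
    {ae P, forall w, enorm (r (X w) (est w) - r (X w) (th (tr w))) <=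
      C * enorm (est w - th (tr w))} ->
    ('E_P[fun w => (enorm (est w - th (tr w)) ^+ 2)%R] <= D%:E)%E ->
    0 < eta ->
  (`|pred_risk P r theta est X i j - indep_risk P r theta (th \o tr) mu i j| <=
    (B + (eta * (q + B) + (eta^-1 + 1) * C ^+ 2 * D))%:E)%E.
Proof.
move=> lawX fd ffd mDr ma mdel rhoq hB lip + eta0; rewrite unlock => delD.
have rhoy l : (indep_risk P r theta (th \o tr) mu l l < +oo)%E.
  by rewrite (le_lt_trans (rhoq l))// ltry.
have mix l m := @mixing_risk_comparison _ _ _ _ _ _ _ _ _ P mu X tr r theta th
  lambda f fX fXi lawX fd ffd mDr B l m rhoy hB.
pose b w := Delta_r r theta th (X w, tr w).
have mb l : measurable_fun setT (fun w => b w l 0).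
  by apply: (measurableT_comp (mDr l)); exact/measurable_fun_pair.
(* The diagonal moment of [b] lies within [B] of the risk bounded by [q]; hence [q + B] in the
   conclusion. *)
have bq l : (\int[P]_w (b w l 0 * b w l 0)%:E <= (q + B)%:E)%E.
  have [rhofin _ mixB] := mix l l.
  rewrite EFinD; apply: le_trans (leeD (rhoq l) (lexx _)).
  by rewrite -leeBlDl//; apply: le_trans mixB; exact: lee_abs.
have ib l m : P.-integrable setT (fun w => (b w l 0 * b w m 0)%:E).
  by have [] := mix l m.
have ab : {ae P, forall w, enorm (r (X w) (est w) - r (X w) theta - b w) <=
    C * enorm (est w - th (tr w))}.
  by apply: filterS lip => w; rewrite /b /Delta_r opprB addrA subrK.
have [_ aabb] := second_moment_perturbation i j ma mb mdel ib bq ab delD eta0.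
have [_ intbb mixB] := mix i j.
rewrite /pred_risk mxE unlock.
under eq_integral do rewrite outerE.
have vfin := integrable_fin_num measurableT intbb.
rewrite EFinD; apply: le_trans (leeD mixB aabb).
rewrite [leRHS]addeC.
(* Inserting the intermediate moment is legitimate in [\bar R] because [vfin] makes it finite. *)
rewrite -[X in (`|X - _|)%E](subeK _ vfin) -(addeA (_ - _)%E).
exact: lee_abs_add.
Qed.

(** * Limits of extended real functions *)

(** Finiteness of [y] near the limit comes for free: an infinite value would be at distance [+oo]
    from the finite [x t]. *)
Lemma cvge_close (R : realType) (I : Type) (F : set_system I) {FF : Filter F}
    (x y : I -> \bar R) (l : R) :
    x t @[t --> F] --> l%:E ->
    (forall e, 0 < e -> \forall t \near F, (`|y t - x t| <= e%:E)%E) ->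
  y t @[t --> F] --> l%:E.
Proof.
move=> /fine_cvgP[xfin /cvgrPdist_le xl] yx.
have yfin : \forall t \near F, y t \is a fin_num.
  near=> t; have xt : x t \is a fin_num by near: t.
  have : (`|y t - x t| <= 1%:E)%E by near: t; exact: yx.
  by move: (x t) xt (y t) => [?||]// _ [].
apply/fine_cvgP; split=> //; apply/cvgrPdist_le => e e0; near=> t.
have xt : x t \is a fin_num by near: t.
have yt : y t \is a fin_num by near: t.
have xlt : `|l - fine (x t)| <= e / 2 by near: t; apply: xl; rewrite divr_gt0.
have : (`|y t - x t| <= (e / 2)%:E)%E by near: t; apply: yx; rewrite divr_gt0.
rewrite -(fineK xt) -(fineK yt) -EFinB lee_fin => yxt /=.
rewrite (_ : l - _ = (l - fine (x t)) - (fine (y t) - fine (x t))); last by ring.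
by rewrite [leRHS]splitr (le_trans (ler_normB _ _))// lerD.
Unshelve. all: by end_near. Qed.

Lemma cvge_near_le (R : realType) (I : Type) (F : set_system I) {FF : Filter F}
    (x : I -> \bar R) (l M : R) :
  x t @[t --> F] --> l%:E -> l < M -> \forall t \near F, (x t <= M%:E)%E.
Proof.
move=> /fine_cvgP[xfin /cvgr_lt xl] lM; near=> t.
have xt : x t \is a fin_num by near: t.
rewrite -(fineK xt) lee_fin ltW//.
by near: t; exact: xl.
Unshelve. all: by end_near. Qed.

(** * The mixing coefficient as a total mass *)

Section mixing_rate.
Context d1 d2 (E : measurableType d1) (Xi : measurableType d2) (R : realType).
Variables (lambda : {measure set (E * Xi) -> \bar R})
  (f : {mfun (E * Xi)%type >-> R}) (fX : {mfun E >-> R}) (fXi : {mfun Xi >-> R}).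
Variables (mu1 mu2 : set (E * Xi) -> \bar R).
Hypotheses (mu1T : mu1 setT = 1%E) (mu2T : mu2 setT = 1%E).
Hypotheses (f_density : is_density lambda f mu1)
  (fXfXi_density : is_density lambda (fun z => fX z.1 * fXi z.2) mu2).

(** [beta_bar] is a real-valued integral, with value 0 if the extended one is infinite. This default
    does not occur: [Delta_f] is at most the sum of two densities of total mass 1. *)
Lemma Delta_f_measureT :
  Delta_f_measure lambda f fX fXi setT = (beta_bar lambda f fX fXi)%:E.
Proof.
rewrite /Delta_f_measure /beta_bar /Rintegral fineK//.
have [f0 fE] := f_density; have [p0 pE] := fXfXi_density.
have mp : measurable_fun [set: E * Xi] (fun z => fX z.1 * fXi z.2).
  by apply: measurable_funM; apply: measurableT_comp.
have mDf := measurable_Delta_f f fX fXi.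
rewrite ge0_fin_numE; last by apply: integral_ge0 => z _; rewrite lee_fin Delta_f_ge0.
apply: (@le_lt_trans _ _ (\int[lambda]_z ((f z)%:E + (fX z.1 * fXi z.2)%:E))%E).
  apply: ge0_le_integral => //.
  - by move=> z _; rewrite lee_fin Delta_f_ge0.
  - exact/measurable_EFinP.
  - by apply: emeasurable_funD; exact/measurable_EFinP.
  - move=> z _; rewrite -EFinD lee_fin (le_trans (ler_normB _ _))//.
    by rewrite [`|f z|]ger0_norm// ger0_norm.
rewrite ge0_integralD//.
- by rewrite -fE// -pE// mu1T mu2T ltry.
- by move=> z _; rewrite lee_fin.
- exact/measurable_EFinP.
- by move=> z _; rewrite lee_fin.
- exact/measurable_EFinP.
Qed.

Lemma integral_sqr_Delta_f (h : E * Xi -> R) (m : \bar R) (K : R) :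
    (2%:E < m)%E -> measurable_fun setT h -> (forall z, 0 <= h z) ->
    (Lnorm (Delta_f_measure lambda f fX fXi) m (EFin \o h) <= K%:E)%E ->
  (\int[lambda]_z (h z ^+ 2 * Delta_f f fX fXi z)%:E <=
    (K ^+ 2 * beta_bar lambda f fX fXi `^ (mixing_exponent m)^-1)%:E)%E.
Proof.
move=> m2 mh h0 hK.
have := integral_sqr_le_Lnorm m2 mh h0 hK Delta_f_measureT.
rewrite (integral_density (nu := lambda) (measurable_Delta_f f fX fXi))//.
  by split=> // z; exact: Delta_f_ge0.
exact: measurable_funX.
Qed.

End mixing_rate.

Lemma mixing_exponent_gt0 (R : realType) (m : \bar R) :
  (2%:E < m)%E -> 0 < mixing_exponent m.
Proof.
case: m => [m||]//=; rewrite lte_fin => m2.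
by rewrite divr_gt0// ?subr_gt0// (lt_trans _ m2).
Qed.

(** * Choice of constants and passage to the limit *)

Theorem theorem3p1
  (R : realType) (d k : nat)
  (time : set R) (time_set : is_time_set time)
  (dO dE : measure_display)
  (Omega : measurableType dO) (E : measurableType dE)
  (Theta : set 'cV[R]_d)
  (P : 'cV[R]_d -> probability Omega R)
  (X : R -> {mfun Omega >-> E})
  (Y : R -> Omega -> 'cV[R]_k)
  (mu : 'cV[R]_d -> probability E R)
  (law_X : forall theta T, Theta theta -> time T ->
    forall A, measurable A -> distribution (P theta) (X T) A = mu theta A)
  (r : E -> 'cV[R]_d -> 'cV[R]_k)
  (r_regression : forall theta T, Theta theta -> time T ->
    is_regression (P theta) (X T) (Y T) (mu theta) (r ^~ theta))
  (r_measurable : @trace_measurable_fun _ _ (E * borelV R d)%type (borelV R k)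
    ([set: E] `*` Theta) (fun z => r z.1 z.2))
  (J : E -> 'cV[R]_d -> 'M[R]_(k, d))
  (r_differentiable : forall x theta, Theta theta ->
    (fun t => r x t - r x theta - J x theta *m (t - theta))
      =o_ (within Theta (nbhs theta)) (fun t => t - theta))
  (r_L2 : forall theta, Theta theta ->
    forall i, (fun x => r x theta i 0) \in Lfun (mu theta) 2%:E)
  (J_L2 : forall theta, Theta theta ->
    forall i j, (fun x => J x theta i j) \in Lfun (mu theta) 2%:E)
  (paths : R -> pointedType)
  (ev : forall S, paths S -> window time S -> E)
  (ev_inj : forall S, time S -> injective (ev S))
  (traj : forall S, {mfun Omega >-> pathType (ev S)})
  (ev_traj : forall S w (t : window time S), time S ->
    ev S (traj S w) t = X (sval t) w)
  (thbar : forall S, paths S -> 'cV[R]_d)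
  (thbar_Theta : forall S xi, time S -> Theta (thbar S xi))
  (thbar_measurable : forall S, time S ->
    @measurable_fun _ _ (pathType (ev S)) (borelV R d) setT (thbar S))
  (S : R -> R)
  (S_time : forall T, time T -> time (S T))
  (S_le : forall T, time T -> S T <= T)
  (S_equiv : S T / T @[T --> time_oo time] --> (1 : R))
  (lambda : forall T,
    {sigma_finite_measure set (E * pathType (ev (S T)))%type -> \bar R})
  (f : forall (theta : 'cV[R]_d) T,
    {mfun (E * pathType (ev (S T)))%type >-> R})
  (fX : forall (theta : 'cV[R]_d) (T : R), {mfun E >-> R})
  (fXS : forall (theta : 'cV[R]_d) T, {mfun pathType (ev (S T)) >-> R})
  (f_density : forall theta T, Theta theta -> time T ->
    is_density (lambda T) (f theta T)
      (pushforward (P theta) (fun w => (X T w, traj (S T) w))))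
  (fX_density : forall theta T, Theta theta -> time T ->
    exists nu : {measure set E -> \bar R},
      is_density nu (fX theta T) (distribution (P theta) (X T)))
  (fXS_density : forall theta T, Theta theta -> time T ->
    exists nu : {measure set (pathType (ev (S T))) -> \bar R},
      is_density nu (fXS theta T) (distribution (P theta) (traj (S T))))
  (fX_fXS_density : forall theta T, Theta theta -> time T ->
    is_density (lambda T) (fun z => fX theta T z.1 * fXS theta T z.2)
      (distribution (P theta) (X T) \x distribution (P theta) (traj (S T)))%E)
  (mixing : forall theta, Theta theta -> exists m : \bar R,
    [/\ (2%:E < m)%E,
        (ereal_sup ((fun T =>
            Lnorm (Delta_f_measure (lambda T)
                     (f theta T) (fX theta T) (fXS theta T)) m
              (fun z => (enorm (Delta_r r theta (thbar (S T)) z))%:E))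
          @` time) < +oo)%E &
        (fun T => beta_bar (lambda T) (f theta T) (fX theta T) (fXS theta T))
          =o_ (time_oo time) (fun T => T `^ (- mixing_exponent m))])
  (est_close : forall theta, Theta theta ->
    (T%:E * 'E_(P theta)[fun w =>
        (enorm (thbar T (traj T w) - thbar (S T) (traj (S T) w)) ^+ 2)%R])%E
      @[T --> time_oo time] --> 0%E)
  (Rlim : 'cV[R]_d -> 'M[R]_k)
  (rhoS_lim : forall theta, Theta theta ->
    scaled_cvg time (fun T => indep_risk (P theta) r theta
      (fun w => thbar (S T) (traj (S T) w)) (mu theta)) (Rlim theta))
  (rho_lim : forall theta, Theta theta ->
    scaled_cvg time (fun T => indep_risk (P theta) r theta
      (fun w => thbar T (traj T w)) (mu theta)) (Rlim theta))
  (C : R) (C_gt0 : 0 < C)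
  (r_lipschitz : forall theta0 T, Theta theta0 -> time T ->
    {ae P theta0, forall w, forall theta theta', Theta theta -> Theta theta' ->
      enorm (r (X T w) theta' - r (X T w) theta) <= C * enorm (theta' - theta)}) :
  forall theta, Theta theta ->
    scaled_cvg time (fun T => pred_risk (P theta) r theta
      (fun w => thbar T (traj T w)) (X T)) (Rlim theta).
Proof.
move=> theta Th i j.
have [m [m2 sup_lty /eqoP beta_o]] := mixing theta Th.
pose p := mixing_exponent m.
have p0 : 0 < p := mixing_exponent_gt0 m2.
pose h T (z : E * pathType (ev (S T))) := enorm (Delta_r r theta (thbar (S T)) z).
pose rho T := indep_risk (P theta) r theta
  (fun w => thbar (S T) (traj (S T) w)) (mu theta).
have near_time : \forall T \near time_oo time, time T.
  exact: withinT.
have near_gt0 : \forall T \near time_oo time, 0 < T.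
  by apply: cvg_within; exact: nbhs_pinfty_gt.
have mthbar T : time T ->
    @measurable_fun _ _ Omega (borelV R d) setT (fun w => thbar T (traj T w)).
  move=> tT; exact: (@measurableT_comp _ _ _ _ (pathType (ev T)) (borelV R d)
    _ setT (traj T) (thbar_measurable T tT) (measurable_funP (traj T))).
have mDr T l : time T -> measurable_fun setT
    (fun z : E * pathType (ev (S T)) => Delta_r r theta (thbar (S T)) z l 0).
  move=> tT; under eq_fun do rewrite !mxE.
  apply: measurable_funB; apply: measurable_regression r_measurable _ _ _ => //.
  - exact: (@measurableT_comp _ _ _ _ (pathType (ev (S T))) (borelV R d)
      _ setT snd (thbar_measurable _ (S_time T tT)) measurable_snd).
  - by move=> z; exact/thbar_Theta/S_time.
have mpred T l : time T -> measurable_fun setT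
    (fun w => (r (X T w) (thbar T (traj T w)) - r (X T w) theta) l 0).
  move=> tT; under eq_fun do rewrite !mxE.
  apply: measurable_funB; apply: measurable_regression r_measurable _ _ _ => //.
  - exact: (mthbar T tT).
  - by move=> w; exact: thbar_Theta.
have mdel T : time T -> measurable_fun setT
    (fun w => enorm (thbar T (traj T w) - thbar (S T) (traj (S T) w))).
  move=> tT; apply: measurable_enorm => l; under eq_fun do rewrite !mxE.
  apply: measurable_funB; apply: (measurableT_comp (measurable_coord l)).
  - exact: (mthbar T tT).
  - exact: (mthbar _ (S_time T tT)).
pose L T := Lnorm (Delta_f_measure (lambda T) (f theta T) (fX theta T)
  (fXS theta T)) m (EFin \o @h T).
pose K := fine (ereal_sup (L @` time)).
(* Taking [fine] loses nothing: the supremum is below [+oo] by assumption, and nonnegative as soon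
   as some time exists. *)
have LK T : time T -> (L T <= K%:E)%E.
  move=> tT; have Lsup : (L T <= ereal_sup (L @` time))%E.
    by apply: ereal_sup_ubound; exists T.
  by rewrite /K fineK// ge0_fin_numE// (le_trans _ Lsup)// Lnorm_ge0.
have mix e : 0 < e -> \forall T \near time_oo time,
    (\int[lambda T]_z (h T z ^+ 2 *
      Delta_f (f theta T) (fX theta T) (fXS theta T) z)%:E <= (e / T)%:E)%E.
  move=> e0; have K20 : 0 < K ^+ 2 + 1 by rewrite ltr_wpDl ?sqr_ge0.
  (* Adding 1 covers [K = 0]. The little-o assumption is used with the [p]-th power of this
     constant, so that after the [p]-th root and multiplication by [K ^+ 2] at most [e / T]
     remains. *)
  have a0 : 0 < e / (K ^+ 2 + 1) by rewrite divr_gt0.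
  have := beta_o _ (powR_gt0 p a0); 
  apply: filterS3 near_time near_gt0 => T tT T0.
  set beta := beta_bar _ _ _ _ => betaT.
  have b0 : 0 <= beta by apply: Rintegral_ge0 => z _; exact: Delta_f_ge0.
  have mh : measurable_fun setT (@h T).
    by apply: measurable_enorm => l; exact: mDr.
  apply: (le_trans (integral_sqr_Delta_f _ _ (f_density theta T Th tT)
    (fX_fXS_density theta T Th tT) m2 mh _ (LK T tT))).
  - exact: (probability_setT (P theta)).
  - rewrite -setXTT product_measure1E//.
    have d1 := probability_setT (distribution (P theta) (X T)).
    have d2 := probability_setT (distribution (P theta) (traj (S T))).
    by rewrite [X in (X * _)%E]d1 [X in (_ * X)%E]d2 mule1.
  - by move=> z; exact: enorm_ge0.
  (* The [p]-th root turns the rate [T ^ (- p)] into exactly [1 / T]. *)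
  have : beta `^ p^-1 <= e / (K ^+ 2 + 1) / T.
    have -> : e / (K ^+ 2 + 1) / T =
        ((e / (K ^+ 2 + 1)) `^ p * T `^ (- p)) `^ p^-1.
      rewrite powRM ?powR_ge0// -!powRrM mulNr divff ?gt_eqF//.
      by rewrite powRr1 ?ltW// powRN powRr1// ltW.
    rewrite ge0_ler_powR ?invr_ge0 ?nnegrE ?mulr_ge0 ?powR_ge0 ?(ltW p0)//.
    by move: betaT; rewrite ger0_norm// ger0_norm ?powR_ge0.
  move=> /(ler_wpM2l (sqr_ge0 K)) hb; rewrite lee_fin (le_trans hb)//.
  rewrite !mulrA ler_pM2r ?invr_gt0// ler_pdivrMr// mulrC ler_pM2l//.
  by rewrite lerDl.
have rhoS_fin : \forall T \near time_oo time, rho T i j \is a fin_num.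
  have /fine_cvgP[+ _] := rhoS_lim theta Th i j.
  apply: filterS2 near_gt0 => T T0; rewrite -/(rho T).
  by case: (rho T i j) => //; rewrite ?gt0_muley ?gt0_muleNy ?lte_fin.
(* [M] strictly exceeds every diagonal limit, so it eventually bounds all diagonal entries of
   [T * rho T] at once. *)
pose M := 1 + \sum_l `|Rlim theta l l|.
have M0 : 0 < M by rewrite ltr_pwDl// sumr_ge0.
have rhoM : \forall T \near time_oo time, forall l, (T%:E * rho T l l <= M%:E)%E.
  apply: filter_forall => l; apply: (cvge_near_le (rhoS_lim theta Th l l)).
  rewrite /M (bigD1 l)//= ltr_pwDl// (le_trans (ler_norm _))// lerDl.
  by rewrite sumr_ge0.
(* As [Rlim] is the common limit, it suffices that [T] times the prediction risk eventually lies
   within [e] of [T * rho T]. *)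
apply: (cvge_close (rhoS_lim theta Th i j)) => e e0.
(* With these constants each of the three error terms, multiplied by [T], is at most [e / 4]. The
   cap [b <= 1] gives [eta * (M + b) <= eta * (M + 1) = e / 4]. *)
pose eta := e / (4 * (M + 1)).
have eta0 : 0 < eta by rewrite divr_gt0// mulr_gt0// addr_gt0.
pose del := e / (4 * ((eta^-1 + 1) * C ^+ 2)).
have c0 : 0 < (eta^-1 + 1) * C ^+ 2.
  by rewrite mulr_gt0// ?exprn_gt0// addr_gt0// invr_gt0.
have del0 : 0 < del by rewrite divr_gt0// mulr_gt0.
pose b := Num.min 1 (e / 4).
have b0 : 0 < b by rewrite lt_min ltr01 divr_gt0.
have delD : \forall T \near time_oo time, (T%:E * 'E_(P theta)[fun w =>
    (enorm (thbar T (traj T w) - thbar (S T) (traj (S T) w)) ^+ 2)%R] <= del%:E)%E.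
  exact: (cvge_near_le (est_close theta Th)).
near=> T.
have tT : time T by near: T.
have T0 : 0 < T by near: T.
have rhofin : rho T i j \is a fin_num by near: T.
have rhoq l : (rho T l l <= (M / T)%:E)%E.
  rewrite mulrC EFinM lee_pdivlMl//.
  by move: l; near: T.
have hB : (\int[lambda T]_z (h T z ^+ 2 *
    Delta_f (f theta T) (fX theta T) (fXS theta T) z)%:E <= (b / T)%:E)%E.
  by near: T; exact: mix.
have hD : ('E_(P theta)[fun w =>
    (enorm (thbar T (traj T w) - thbar (S T) (traj (S T) w)) ^+ 2)%R]
    <= (del / T)%:E)%E.
  by rewrite mulrC EFinM lee_pdivlMl//; near: T.
have lip : {ae P theta, forall w,
    enorm (r (X T w) (thbar T (traj T w)) - r (X T w) (thbar (S T) (traj (S T) w)))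
      <= C * enorm (thbar T (traj T w) - thbar (S T) (traj (S T) w))}.
  (* The null set in the Lipschitz assumption is the same for all pairs of parameters, so the random
     estimates may be substituted for them. *)
  apply: filterS (r_lipschitz theta T Th tT) => w; apply.
    exact/thbar_Theta/S_time.
  exact: thbar_Theta.
have key := pred_risk_comparison i j (law_X theta T Th tT) (f_density theta T Th tT)
  (fX_fXS_density theta T Th tT) (fun l => mDr T l tT) (fun l => mpred T l tT)
  (mdel T tT) rhoq hB lip hD eta0.
(* Factoring [T] out of the difference uses that [rho T i j] is finite; the prediction risk is not
   yet known to be. *)
rewrite -muleBr//; last by rewrite fin_num_adde_defl// fin_numN.
rewrite abseM gee0_abs ?lee_fin ?(ltW T0)// -lee_pdivlMl//.
rewrite (le_trans key)// -EFinM lee_fin.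
have -> : b / T + (eta * (M / T + b / T) + (eta^-1 + 1) * C ^+ 2 * (del / T)) =
    T^-1 * (b + eta * (M + b) + (eta^-1 + 1) * C ^+ 2 * del) by ring.
rewrite ler_wpM2l ?invr_ge0 ?(ltW T0)//.
have -> : (eta^-1 + 1) * C ^+ 2 * del = e / 4.
  by rewrite /del; field; rewrite !gt_eqF// addr_gt0.
have b1 : b <= 1 by rewrite ge_min lexx.
have b4 : b <= e / 4 by rewrite ge_min lexx orbT.
have : eta * (M + b) <= e / 4.
  have -> : e / 4 = eta * (M + 1).
    by rewrite /eta; field; rewrite gt_eqF// addr_gt0.
  by rewrite ler_pM2l// lerD2l.
lra.
Unshelve. all: end_near. Qed.
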